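(* Let $g$ be a connected social network on $N=\{1,\dots,n\}$ that is completely informative. Then an ex post incentive-compatible and ex post efficient direct mechanism exists if and only if for every pair of distinct individuals $i,j\in N$ there exists a third individual $k\in N\setminus\{i,j\}$ who observes both $i$ and $j$, i.e. $g_{ik}g_{jk}=1$.
   Context: Setting. $N=\{1,\dots,n\}$ is a set of individuals and $g$ is a connected, undirected simple graph on $N$ (the social network), commonly known; $g_{ij}=1$ if $i,j$ are linked (friends), $g_{ij}=0$ otherwise. Each individual $i$ has a real characteristic $\theta_i$; a realization is a vector $(\theta_1,\dots,\theta_n)$ with pairwise distinct entries. Individual $i$ observes the ordinal comparison between distinct $j$ and $k$ if and only if each of $j,k$ is either $i$ himself or a friend of $i$ in $g$. Types. Individual $i$'s type is a matrix $T^i=[t^i_{jk}]$ with $t^i_{jk}\in\{-1,0,1\}$, $t^i_{jk}=-t^i_{kj}$, and $t^i_{jk}\neq 0$ if and only if $i$ observes the comparison between $j$ and $k$; $t^i_{jk}=1$ means $\theta_j>\theta_k$ and $t^i_{jk}=-1$ means $\theta_j<\theta_k$. Any matrix of this form may be reported by $i$. A vector of (true) types is a profile ${\bf T}=(T^1,\dots,T^n)$ generated by some realization $(\theta_1,\dots,\theta_n)$. Induced order. For a vector of types ${\bf T}$, write $i\succ_{\bf T} j$ if there is $k$ with $t^k_{ij}=1$, or there are individuals $i=i^0,\dots,i^M=j$ and $k^0,\dots,k^{M-1}$ with $t^{k^m}_{i^m i^{m+1}}=1$ for all $m=0,\dots,M-1$. The network $g$ is completely informative if, for every realization of the characteristics,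 the generated $\succ_{\bf T}$ is a complete (total) ranking of $N$. Mechanisms. A direct mechanism assigns to every vector of reported matrices a complete ranking $\rho$ of $N$, i.e. a bijection $i\mapsto\rho_i\in\{1,\dots,n\}$. Individuals care only about their own rank and strictly prefer higher $\rho_i$ (rank $1$ is worst). The mechanism is ex post incentive compatible if for every individual $i$, every vector of types ${\bf T}=(T^i,T^{-i})$ and every report $T'^i$ of $i$, $\rho_i({\bf T})\ge\rho_i(T'^i,T^{-i})$. It is ex post efficient if for every vector of types ${\bf T}$ and all $i,j$, $i\succ_{\bf T} j$ implies $\rho_i({\bf T})>\rho_j({\bf T})$. *)

(* Defs.v *)
From HB Require Import structures.
From mathcomp Require Import all_boot all_order all_fingroup all_algebra.
From mathcomp Require Import reals.
Set Implicit Arguments.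
Unset Strict Implicit.
Unset Printing Implicit Defensive.
Import Order.TTheory GRing.Theory Num.Theory.
Local Open Scope ring_scope.

Definition observes n (g : rel 'I_n) (i j k : 'I_n) : bool :=
  [&& j != k, (j == i) || g i j & (k == i) || g i k].

(* No transitivity is required: a reported matrix may contain cycles. *)
Definition is_type n (g : rel 'I_n) (i : 'I_n) (A : 'M[int]_n) : bool :=
  [forall j, forall k,
    [&& A j k \in [:: -1; 0; 1], A j k == - A k j
      & (A j k != 0) == observes g i j k]].

Definition report n (g : rel 'I_n) (i : 'I_n) : Type :=
  {A : 'M[int]_n | is_type g i A}.

Definition profile n (g : rel 'I_n) : Type := forall i : 'I_n, report g i.

Definition entry n (g : rel 'I_n) (T : profile g) (i j k : 'I_n) : int :=
  \val (T i) j k.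

Definition generates (R : realType) n (g : rel 'I_n)
    (theta : 'I_n -> R) (T : profile g) : Prop :=
  forall i j k : 'I_n, observes g i j k ->
    (entry T i j k = 1 <-> theta j > theta k) /\
    (entry T i j k = -1 <-> theta j < theta k).

Definition truthful (R : realType) n (g : rel 'I_n) (T : profile g) : Prop :=
  exists theta : 'I_n -> R, injective theta /\ generates theta T.

Definition reported_above n (g : rel 'I_n) (T : profile g) : rel 'I_n :=
  fun i j => [exists k, entry T k i j == 1].

(* Chains have at least one step; one-step chains are the direct reports. *)
Definition induced n (g : rel 'I_n) (T : profile g) (i j : 'I_n) : Prop :=
  exists p : seq 'I_n,
    [/\ p != [::], path (reported_above T) i p & last i p = j].

Definition complete_ranking (A : Type) (r : A -> A -> Prop) : Prop :=
  [/\ forall x, ~ r x x,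
      forall x y z, r x y -> r y z -> r x z
    & forall x y, x <> y -> r x y \/ r y x].

Definition completely_informative (R : realType) n (g : rel 'I_n) : Prop :=
  forall theta : 'I_n -> R, injective theta ->
  forall T : profile g, generates theta T -> complete_ranking (induced T).

(* Ranks are numbered from 0 (worst) to n - 1 (best); only their order is
   ever used.  The domain is all profiles of reports, consistent or not. *)
Definition mechanism n (g : rel 'I_n) : Type := profile g -> 'S_n.

(* Incentive compatibility and efficiency quantify over the vectors of types
   generated by some realization; only the misreport B is unrestricted. *)
Definition ex_post_IC (R : realType) n (g : rel 'I_n) (rho : mechanism g) :
    Prop :=
  forall (i : 'I_n) (T : profile g) (B : report g i), truthful R T ->
    (rho T i >= rho (dfwith T B) i)%N.

Definition ex_post_efficient (R : realType) n (g : rel 'I_n)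
    (rho : mechanism g) : Prop :=
  forall (T : profile g), truthful R T ->
  forall i j : 'I_n, induced T i j -> (rho T i > rho T j)%N.

(* Main.v *)
(** Necessity: if i and j have no third observer, take two realizations in which
i and j are the two lowest, in either order.  The two true profiles differ only
in the reports of i and j, so the profile in which each of them claims to beat
the other is one deviation away from both truths, and incentive compatibility
puts both i and j at the bottom of it.

Sufficiency: call i suspect in a profile if all reports but that of i agree
with some ranking, so that i may be a deviator whose true rank has to bound his
assigned rank.  The reports of third observers order the suspects totally;
the mechanism ranks them in this order below everybody else.  A suspect is then
ranked by the number of suspects that others place below him, which is at most
his true rank.  At a true profile everybody is suspect, and the mechanism
returns the true ranking. *)

Require Import Defs.
From HB Require Import structures.
From mathcomp Require Import all_boot all_order all_fingroup all_algebra.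
From mathcomp Require Import boolp reals.
Set Implicit Arguments.
Unset Strict Implicit.
Unset Printing Implicit Defensive.
Import Order.TTheory GRing.Theory Num.Theory.
Local Open Scope ring_scope.

(** * Permutations obtained by counting the elements below *)

Lemma card_below_mono d (K : orderType d) n (key : 'I_n -> K) i j :
  (key i < key j)%O ->
  (#|[set k | (key k < key i)%O]| < #|[set k | (key k < key j)%O]|)%N.
Proof.
move=> ij; apply: proper_card; apply/properP; split.
  by apply/subsetP => k; rewrite !inE => /lt_trans; apply.
by exists i; rewrite !inE ?ltxx.
Qed.

Lemma perm_of_injective_key n (key : 'I_n -> nat) : injective key ->
  exists s : 'S_n, forall i, s i = #|[set j | (key j < key i)%N]| :> nat.
Proof.
move=> key_inj.
pose below i := [set j | (key j < key i)%N].
have below_lt i : (#|below i| < n)%N.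
  rewrite -[X in (_ < X)%N]card_ord -cardsT; apply: proper_card.
  by apply/properP; split; [exact: subsetT|exists i; rewrite !inE ?ltnn].
have rank_inj : injective (fun i => Ordinal (below_lt i)).
  move=> i j /(congr1 val) /= eq_ij; apply: key_inj; apply/eqP.
  by case: ltngtP => // /(@card_below_mono _ nat); rewrite -/(below _) eq_ij ltnn.
by exists (perm rank_inj) => i; rewrite permE.
Qed.

(** The members of [S] are placed below all others, so the rank of a member depends only on the
    order within [S]. *)
Lemma perm_initial_segment n (S : {set 'I_n}) (lt : rel 'I_n) :
    {in S, irreflexive lt} -> {in S & &, transitive lt} ->
    {in S &, forall i j, i != j -> lt i j || lt j i} ->
  exists s : 'S_n, {in S, forall i, s i = #|[set j in S | lt j i]| :> nat}.
Proof.
move=> irr tr tot.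
pose below i := [set j in S | lt j i].
have below_mono : {in S &, forall i j, lt i j -> (#|below i| < #|below j|)%N}.
  move=> i j iS jS ij; apply: proper_card; apply/properP; split.
    apply/subsetP => k; rewrite !inE => /andP[kS ki].
    by rewrite kS (tr i k j).
  by exists i; rewrite !inE ?iS //= irr.
have below_le i : (#|below i| <= n)%N.
  by rewrite -[X in (_ <= X)%N]card_ord max_card.
(* Counts are at most [n], so the offset [n.+1] puts non-members above every member. *)
pose key i : nat := if i \in S then #|below i| else (n.+1 + i)%N.
have key_lt i j : i \in S -> j \notin S -> (key i < key j)%N.
  by rewrite /key => -> /negPf ->; rewrite addSn ltnS; apply/leq_trans/leq_addr.
have key_inj : injective key.
  move=> i j eq_ij; case: (boolP (i \in S)) => iS; case: (boolP (j \in S)) => jS.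
  - apply/eqP/contraT => /(tot _ _ iS jS)/orP[] /below_mono;
      by move: eq_ij; rewrite /key iS jS => -> /(_ _ _)/[!ltnn]; apply.
  - by have := key_lt _ _ iS jS; rewrite eq_ij ltnn.
  - by have := key_lt _ _ jS iS; rewrite eq_ij ltnn.
  - apply/val_inj/(@addnI n.+1).
    by move: eq_ij; rewrite /key (negPf iS) (negPf jS).
have [s sE] := perm_of_injective_key key_inj.
exists s => i iS; rewrite sE; apply: eq_card => j; rewrite !inE.
case: (boolP (j \in S)) => [jS|jS] /=; last first.
  by apply/negbTE; rewrite -leqNgt ltnW ?key_lt.
rewrite /key iS jS; have [->|/(tot _ _ jS iS)] := eqVneq j i.
  by rewrite ltnn irr.
case: (boolP (lt j i)) => [ji _|_ /= ij]; first exact: below_mono.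
by apply/negbTE; rewrite -leqNgt ltnW ?below_mono.
Qed.

(** * Reports and realizations agreeing with them *)

Lemma entry_observes n (g : rel 'I_n) (T : profile g) k a b :
  entry T k a b != 0 -> observes g k a b.
Proof.
by have /forallP/(_ a)/forallP/(_ b)/and3P[_ _ /eqP->] := valP (T k).
Qed.

Lemma entry_dichotomy n (g : rel 'I_n) (T : profile g) k a b :
  observes g k a b -> entry T k a b = 1 \/ entry T k b a = 1.
Proof.
have /forallP/(_ a)/forallP/(_ b)/and3P[/[!inE] v /eqP anti /eqP nz] := valP (T k).
rewrite -nz => v0; rewrite /entry.
case/or3P: v => /eqP v; [right|by rewrite v eqxx in v0|by left].
by apply: oppr_inj; rewrite -anti v.
Qed.

(** Constraining the entries equal to 1 suffices: by antisymmetry an entry -1 is an entry 1 of the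
    swapped pair. *)
Definition consistent_off (R : realType) n (g : rel 'I_n) (P : profile g)
    (i : 'I_n) (theta : 'I_n -> R) : Prop :=
  forall k a b, k != i -> entry P k a b = 1 -> theta b < theta a.

Lemma generates_consistent (R : realType) n (g : rel 'I_n) (T : profile g)
    (theta : 'I_n -> R) k a b :
  generates theta T -> entry T k a b = 1 -> theta b < theta a.
Proof.
move=> gen Tab; have /gen[tab _] : observes g k a b.
  by apply: (@entry_observes _ _ T); rewrite Tab oner_neq0.
exact/tab.
Qed.

Lemma induced_lt (R : realType) n (g : rel 'I_n) (T : profile g)
    (theta : 'I_n -> R) i j :
  generates theta T -> induced T i j -> theta j < theta i.
Proof.
move=> gen [p [p0 pp <-]]; elim: p i p0 pp => //= a p IH i _ /andP[/existsP].
case=> k /eqP /(generates_consistent gen) ai.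
by case: p IH => // b p IH /IH - /(_ isT)/lt_trans; apply.
Qed.

(** * Sufficiency: ranking the suspects *)

Section Sufficiency.
Variables (R : realType) (n : nat) (g : rel 'I_n).
Hypothesis g_sym : symmetric g.
Hypothesis third_observer : forall i j : 'I_n, i != j ->
  exists k : 'I_n, [/\ k != i, k != j, g i k & g j k].
Implicit Types (P : profile g) (theta : 'I_n -> R).

(** Third observers may contradict each other, so this can hold in both directions; it is a strict
    order only among suspects. *)
Definition third_above P : rel 'I_n :=
  fun i j => [exists k, [&& k != i, k != j & entry P k i j == 1]].

Lemma third_above_total P i j : i != j -> third_above P i j || third_above P j i.
Proof.
move=> ij; have [k [ki kj gik gjk]] := third_observer ij.
have /(entry_dichotomy P) : observes g k i j.
  by rewrite /observes ij ![g k _]g_sym gik gjk !orbT.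
case=> Pk; apply/orP; [left|right]; apply/existsP; exists k;
  by rewrite ki kj Pk eqxx.
Qed.

(** A third observer of a pair containing [i] is not [i], so [theta] respects his report; since some
    third observer exists, the converse follows by totality. *)
Lemma third_aboveP P i theta a b : consistent_off P i theta ->
  a != b -> (i == a) || (i == b) -> third_above P a b = (theta b < theta a).
Proof.
move=> cons ab iab.
have imp x y : (i == x) || (i == y) -> third_above P x y -> theta y < theta x.
  move=> ixy /existsP[k /and3P[kx ky /eqP]]; apply: cons.
  by apply: contraTneq ixy => <-; rewrite negb_or kx ky.
apply/idP/idP => [|ba]; first exact: imp.
case/orP: (third_above_total P ab) => // /imp.
by rewrite orbC => /(_ iab) /lt_trans/(_ ba); rewrite ltxx.
Qed.

Definition suspect P (i : 'I_n) : Prop :=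
  exists theta, injective theta /\ consistent_off P i theta.

Lemma third_above_neq P i j : third_above P i j -> i != j.
Proof.
case/existsP=> k /and3P[_ _ /eqP Pij].
by have /and3P[] : observes g k i j by apply: (@entry_observes _ _ P); rewrite Pij.
Qed.

(* The only delicate case is when i is the sole third observer of j and k: then
   i is linked to j, hence reports on the pair (i, j) himself, so that a ranking
   that is consistent with all reports but that of k orders all of i, j, k. *)
Lemma third_above_trans P i j k : suspect P i -> suspect P j -> suspect P k ->
  third_above P i j -> third_above P j k -> third_above P i k.
Proof.
case=> [ti [_ ci]] [tj [_ cj]] [tk [_ ck]] Pij Pjk.
have ij := third_above_neq Pij; have jk := third_above_neq Pjk.
have tiji : ti j < ti i by rewrite -(third_aboveP ci) ?eqxx.
have tjji : tj j < tj i by rewrite -(third_aboveP cj) ?eqxx ?orbT.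
have tkkj : tk k < tk j by rewrite -(third_aboveP ck) ?eqxx ?orbT.
have ik : i != k.
  apply: contraTneq Pjk => <-.
  by rewrite (third_aboveP ci) ?eqxx ?orbT 1?eq_sym // -leNgt ltW.
case/existsP: Pjk => l /and3P[lj lk /eqP Pljk].
(* An observer [l] other than [i] is respected by [ti], which then orders the whole chain. *)
have [eli|li] := eqVneq l i; last first.
  by rewrite (third_aboveP ci) ?eqxx // (lt_trans (ci _ _ _ li Pljk)).
have /entry_observes : entry P l j k != 0 by rewrite Pljk.
rewrite eli => /and3P[_ /orP[/eqP ji|gij] _]; first by rewrite ji eqxx in ij.
have /(entry_dichotomy P) : observes g i i j by rewrite /observes ij eqxx gij orbT.
(* As [tj] respects the report of [i] and has [j] below [i], [i] reports himself above [j]; [tk]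
   respects this report too. *)
case=> [Piij|/(cj _ _ _ ij)/(lt_trans tjji)]; last by rewrite ltxx.
rewrite (third_aboveP ck) ?eqxx ?orbT //.
exact: lt_trans tkkj (ck _ _ _ ik Piij).
Qed.

Lemma suspect_mechanism : exists rho : mechanism g, forall P i, suspect P i ->
  rho P i = #|[set j | `[< suspect P j >] & third_above P i j]| :> nat.
Proof.
suff rank P : exists s : 'S_n, forall i, suspect P i ->
    s i = #|[set j | `[< suspect P j >] & third_above P i j]| :> nat.
  by have [rho rhoE] := choice rank; exists rho.
have [|||s sE] := @perm_initial_segment n [set i | `[< suspect P i >]]
  (fun i j => third_above P j i).
- by move=> i _; apply/negbTE/negP => /third_above_neq; rewrite eqxx.
- move=> j i k; rewrite !inE => /asboolP sj /asboolP si /asboolP sk ji kj.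
  exact: third_above_trans kj ji.
- by move=> i j _ _ ij; rewrite orbC third_above_total.
exists s => i si; rewrite sE ?inE; last exact/asboolP.
by apply: eq_card => j; rewrite !inE.
Qed.

Lemma mechanism_exists :
  exists rho : mechanism g, ex_post_IC R rho /\ ex_post_efficient R rho.
Proof.
have [rho rhoE] := suspect_mechanism.
have rho_truthful theta T i : injective theta -> generates theta T ->
    rho T i = #|[set j | theta j < theta i]| :> nat.
  move=> inj gen.
  have cons j : consistent_off T j theta.
    by move=> k a b _; apply: generates_consistent.
  have all_suspect j : suspect T j by exists theta.
  rewrite rhoE //; apply: eq_card => j; rewrite !inE.
  have -> /= : `[< suspect T j >] by apply/asboolP.
  have [->|ji] := eqVneq j i.
    by rewrite ltxx; apply/negbTE/negP => /third_above_neq; rewrite eqxx.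
  by rewrite (third_aboveP (cons i)) ?eqxx // eq_sym.
exists rho; split=> [i T B [theta [inj gen]]|T [theta [inj gen]] i j ij].
  (* The true realization keeps the deviator [i] suspect, and any suspect counted below him is truly
     below him. *)
  have cons : consistent_off (dfwith T B) i theta.
    move=> k a b ki; rewrite /entry dfwith_out 1?eq_sym // -/(entry T k a b).
    exact: generates_consistent.
  rewrite (rho_truthful _ _ _ inj gen) rhoE; last by exists theta.
  apply/subset_leq_card/subsetP => j; rewrite !inE => /andP[_ Pij].
  by rewrite -(third_aboveP cons) ?eqxx ?(third_above_neq Pij).
rewrite !(rho_truthful _ _ _ inj gen).
exact/card_below_mono/(induced_lt gen).
Qed.

End Sufficiency.

(** * Necessity: two opposed realizations *)

Lemma perm_least n (s : 'S_n) j : (forall k, k != j -> (s j < s k)%N) ->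
  s j = 0%N :> nat.
Proof.
move=> least; have n0 : (0 < n)%N by case: n j {s least} => [[]|].
have [<-|/least] := eqVneq ((s^-1)%g (Ordinal n0)) j; by rewrite permKV.
Qed.

Section TruthfulReports.
Variables (n : nat) (g : rel 'I_n) (key : 'I_n -> nat).
Hypothesis key_inj : injective key.

Definition truthful_matrix (i : 'I_n) : 'M[int]_n :=
  \matrix_(j, k) (if observes g i j k then
                    if (key k < key j)%N then 1 else -1 else 0).

Lemma truthful_matrixP i : is_type g i (truthful_matrix i).
Proof.
apply/forallP => j; apply/forallP => k; rewrite !mxE.
have -> : observes g i k j = observes g i j k.
  by rewrite /observes eq_sym; congr (_ && _); exact: andbC.
case: (boolP (observes g i j k)) => [/and3P[jk _ _]|_]; last by rewrite oppr0.
have [//|//|/key_inj/eqP] := ltngtP (key k) (key j).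
by rewrite eq_sym (negPf jk).
Qed.

Definition truthful_profile : profile g :=
  fun i => exist (is_type g i) _ (truthful_matrixP i).

Lemma truthful_profile_generates (R : realType) :
  generates (fun i => (key i)%:R : R) truthful_profile.
Proof.
move=> i j k obs; rewrite /entry /= mxE obs /Order.gt /= !ltr_nat.
case/and3P: obs => jk _ _.
have [||/key_inj/eqP] := ltngtP (key k) (key j); last by rewrite eq_sym (negPf jk).
- by do !split.
- by do !split.
Qed.

End TruthfulReports.

Definition bottom_two n (i j k : 'I_n) : nat :=
  if k == i then 0 else if k == j then 1 else k.+2.

Lemma bottom_two_inj n (i j : 'I_n) : injective (bottom_two i j).
Proof.
move=> a b; rewrite /bottom_two.
case: eqP => [->|_]; case: eqP => [->|_] //; case: eqP => [->|_] //;
  case: eqP => [->|_] //.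
by case=> /val_inj.
Qed.

(** Exchanging the two lowest affects no other comparison, so only an observer of both [i] and [j]
    can tell the two realizations apart. *)
Lemma bottom_two_swap n (i j a b : 'I_n) : i != j -> a != b ->
    ~~ ((a \in [:: i; j]) && (b \in [:: i; j])) ->
  (bottom_two i j a < bottom_two i j b)%N = (bottom_two j i a < bottom_two j i b)%N.
Proof.
move=> ij ab; rewrite /bottom_two !inE.
by case: (eqVneq a i); case: (eqVneq a j); case: (eqVneq b i);
  case: (eqVneq b j) => //=.
Qed.

Theorem theorem1 (R : realType) (n : nat) (g : rel 'I_n)
    (g_sym : symmetric g) (g_irr : irreflexive g)
    (g_conn : forall i j : 'I_n, connect g i j)
    (g_inf : completely_informative R g) :
  (exists rho : mechanism g, ex_post_IC R rho /\ ex_post_efficient R rho)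
  <->
  (forall i j : 'I_n, i != j ->
     exists k : 'I_n, [/\ k != i, k != j, g i k & g j k]).
Proof.
split=> [[rho [ic eff]] i j ij|]; last exact: mechanism_exists.
have [/existsP[k /and4P[]]|/existsPn none] :=
  boolP [exists k, [&& k != i, k != j, g i k & g j k]]; first by exists k.
exfalso.
pose T a b := truthful_profile g (@bottom_two_inj n a b).
pose theta a b (x : 'I_n) : R := (bottom_two a b x)%:R.
have theta_inj a b : injective (theta a b).
  by move=> x y /eqP; rewrite eqr_nat => /eqP/bottom_two_inj.
have gen a b : generates (theta a b) (T a b) by exact: truthful_profile_generates.
have truth a b : truthful R (T a b) by exists (theta a b).
(* Complete informativeness makes any [k] comparable with [a], and [theta] excludes [a] above [k];
   efficiency does the rest. *)
have rank0 a b : rho (T a b) a = 0%N :> nat.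
  apply: perm_least => k ka; apply: eff (truth a b) _ _ _.
  have [_ _ /(_ k a (elimN eqP ka))[//|]] := g_inf _ (theta_inj a b) _ (gen a b).
  by move/(induced_lt (gen a b)); rewrite ltr_nat [X in (_ < X)%N]/bottom_two eqxx.
(* The same profile is a deviation of [j] from [T j i] and of [i] from [T i j], at each of which the
   deviator has rank 0. *)
have mix : dfwith (T j i) (T i j j) = dfwith (T i j) (T j i i).
  apply: functional_extensionality_dep => k.
  have [->|ki] := eqVneq k i.
    by rewrite dfwith_in dfwith_out // eq_sym.
  have [->|kj] := eqVneq k j.
    by rewrite dfwith_in dfwith_out // eq_sym.
  rewrite !dfwith_out 1?eq_sym //; apply/val_inj/matrixP => a b; rewrite !mxE.
  case: ifP => // /and3P[ab ak bk]; rewrite bottom_two_swap // 1?eq_sym //.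
  (* If the pair were [i] and [j], then [k], being neither, would be linked to both. *)
  apply: contra (none k); rewrite !inE ki kj /= => /andP[bi ai].
  have gk x : (x == j) || (x == i) -> (x == k) || g k x -> g x k.
    by case/orP=> /eqP->; rewrite [_ == k]eq_sym ?(negPf ki) ?(negPf kj) g_sym.
  have {gk} := (gk _ ai ak, gk _ bi bk).
  case/orP: ai ab => /eqP->; case/orP: bi => /eqP->;
    by rewrite ?eqxx // => _ [-> ->].
have : rho (dfwith (T j i) (T i j j)) i = rho (dfwith (T j i) (T i j j)) j.
  apply: val_inj => /=; apply/eqP.
  have := ic j _ (T i j j) (truth j i); have := ic i _ (T j i i) (truth i j).
  by rewrite -mix !rank0 !leqn0 => /eqP-> /eqP->.
by move/perm_inj/eqP; rewrite (negPf ij).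
Qed.
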